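(* Let $(\mathcal{M},g)$ be a Lorentzian manifold of dimension $n>2$ with a concircularly semi-symmetric metric connection $\overset{1}{\nabla}$ with generator $P$. If the vector field $P$ is unit timelike, then $\overset{1}{\nabla}$ is a semi-symmetric metric $P$-connection.
   Context: $\overset{g}{\nabla}$ denotes the Levi-Civita connection of $g$; Lorentzian signature is $(-,+,\dots,+)$. Given a 1-form $\pi$ with associated vector field $P$, $\pi(\cdot)=g(\cdot,P)$, the semi-symmetric metric connection with generator $P$ is $\overset{1}{\nabla}_XY=\overset{g}{\nabla}_XY+\pi(Y)X-g(X,Y)P$. It is called a concircularly semi-symmetric metric connection if there is a scalar function $\omega$ with $(\overset{g}{\nabla}_X\pi)(Y)-\pi(X)\pi(Y)=\omega\, g(X,Y)$ for all vector fields $X,Y$. It is called a semi-symmetric metric $P$-connection if $\overset{1}{\nabla}P=0$. The vector field $P$ is unit timelike if $g(P,P)=-1$. *)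

(* Defs.v *)
From HB Require Import structures.
From mathcomp Require Import all_boot all_order all_algebra.
From mathcomp Require Import all_classical all_reals all_analysis.
From mathcomp Require Import ring.

Set Implicit Arguments.
Unset Strict Implicit.
Unset Printing Implicit Defensive.

Import Order.TTheory GRing.Theory Num.Theory numFieldNormedType.Exports.

Local Open Scope classical_set_scope.
Local Open Scope ring_scope.

Section SmoothEuclidean.
Context {R : realType} {n : nat}.
Implicit Types (U : set 'rV[R]_n) (f g : 'rV[R]_n -> R).

(* [f] is C^k on [U]; only meaningful when [U] is open. *)
Fixpoint Ck (k : nat) U f : Prop :=
  (forall x, U x -> {for x, continuous f}) /\
  if k is k'.+1 then
    forall i : 'I_n, (forall x, U x -> derivable f x 'e_i) /\ Ck k' U ('D_('e_i) f)
  else True.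

Definition Cinfty U f : Prop := forall k, Ck k U f.

Lemma eq_Ck k U f g : open U -> (forall x, U x -> f x = g x) ->
  Ck k U f -> Ck k U g.
Proof.
move=> oU; elim: k f g => [|k IH] f g fg [cf df].
all: have nfg x : U x -> \near x, f x = g x by
  move=> Ux; near=> y; apply: fg; near: y; exact: open_nbhs_nbhs.
all: have cg x : U x -> {for x, continuous g} by
  move=> Ux; rewrite /prop_for /continuous_at -(fg x Ux);
  apply: cvg_trans (cf x Ux); exact: near_eq_cvg (nfg x Ux).
- by split.
- split=> // i; have [dfi Cfi] := df i; split.
    by move=> x Ux; apply: near_eq_derivable (dfi x Ux); exact: nfg.
  by apply: (IH _ _ _ Cfi) => x Ux; apply: near_eq_derive; exact: nfg.
Unshelve. all: by end_near. Qed.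

Lemma CkW k U f : Ck k.+1 U f -> Ck k U f.
Proof.
elim: k f => [|k IH] f [cf df]; split => // i.
by have [dfi Cfi] := df i; split => //; exact: IH.
Qed.

Lemma Ck_cst k U (a : R) : open U -> Ck k U (cst a).
Proof.
move=> oU; elim: k a => [|k IH] a; split => //; try by move=> x _; exact: cst_continuous.
move=> i; split; first by move=> x _; exact: derivable_cst.
by apply: eq_Ck (IH 0) => // x _; rewrite derive_cst.
Qed.

Lemma CkD k U f g : open U -> Ck k U f -> Ck k U g -> Ck k U (f + g).
Proof.
move=> oU; elim: k f g => [|k IH] f g [cf df] [cg dg].
all: have cfg x : U x -> {for x, continuous (f + g)} by
  move=> Ux; apply: continuousD; [exact: cf|exact: cg].
- by split.
split=> // i; have [dfi Cfi] := df i; have [dgi Cgi] := dg i; split.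
  by move=> x Ux; apply: derivableD; [exact: dfi|exact: dgi].
apply: eq_Ck (IH _ _ Cfi Cgi) => // x Ux.
by rewrite deriveD//; [exact: dfi|exact: dgi].
Qed.

Lemma CkM k U f g : open U -> Ck k U f -> Ck k U g -> Ck k U (f * g).
Proof.
move=> oU; elim: k f g => [|k IH] f g Cf Cg.
  by split => // x Ux; apply: continuousM; [exact: Cf.1|exact: Cg.1].
have [[cf df] [cg dg]] := (Cf, Cg).
split=> [x Ux|i]; first by apply: continuousM; [exact: cf|exact: cg].
have [dfi Cfi] := df i; have [dgi Cgi] := dg i; split.
  by move=> x Ux; apply: derivableM; [exact: dfi|exact: dgi].
apply: (@eq_Ck _ _ (f * 'D_('e_i) g + g * 'D_('e_i) f)) => //.
  by move=> x Ux; rewrite deriveM//; [exact: dfi|exact: dgi].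
by apply: CkD => //; apply: IH => //; exact: CkW.
Qed.

End SmoothEuclidean.

Record chart (R : realType) (n : nat) (M : topologicalType) := Chart {
  cdom : set M ;
  ccod : set 'rV[R]_n ;
  chart_coord : M -> 'rV[R]_n ;
  param : 'rV[R]_n -> M ;
  open_cdom : open cdom ;
  open_ccod : open ccod ;
  coord_sub : chart_coord @` cdom `<=` ccod ;
  param_sub : param @` ccod `<=` cdom ;
  coordK : {in cdom, cancel chart_coord param} ;
  paramK : {in ccod, cancel param chart_coord} ;
  chart_coord_continuous : {in cdom, continuous chart_coord} ;
  chart_param_continuous : {in ccod, continuous param} }.

Record manifold (R : realType) (n : nat) := Manifold {
  mspace :> topologicalType ;
  atlas : set (chart R n mspace) ;
  manifold_hausdorff : hausdorff_space mspace ;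
  manifold_second_countable : @second_countable mspace ;
  atlas_cover : forall p : mspace, exists2 c, atlas c & cdom c p ;
  atlas_compatible : forall c c', atlas c -> atlas c' -> forall i : 'I_n,
    Cinfty (ccod c `&` param c @^-1` cdom c')
           (fun x => chart_coord c' (param c x) 0 i) }.

Section SmoothFunctions.
Context {R : realType} {n : nat} (M : manifold R n).

Definition smooth : {pred M -> R} :=
  [pred f : M -> R | `[< forall c, atlas c -> Cinfty (ccod c) (f \o param c) >]].

Lemma smoothP (f : M -> R) :
  reflect (forall c, atlas c -> Cinfty (ccod c) (f \o param c)) (f \in smooth).
Proof. exact: asboolP. Qed.

Lemma smooth_subring_closed : subring_closed smooth.
Proof.
have cstP a : (cst a : M -> R) \in smooth.
  by apply/smoothP => c _ k; apply: (@Ck_cst _ _ _ _ a); exact: open_ccod.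
have mulP f g : f \in smooth -> g \in smooth -> f * g \in smooth.
  move=> /smoothP fS /smoothP gS; apply/smoothP => c cA k.
  by apply: CkM; [exact: open_ccod|exact: fS|exact: gS].
split=> // [|f g fS gS]; first exact: cstP.
have /smoothP NgS : (cst (-1) : M -> R) * g \in smooth by exact: mulP.
move/smoothP : fS => fS; apply/smoothP => c cA k.
have -> : f - g = f + (cst (-1) : M -> R) * g.
  by apply/funext => x; change (f x - g x = f x + -1 * g x); rewrite mulN1r.
by apply: CkD; [exact: open_ccod|exact: fS|exact: NgS].
Qed.

HB.instance Definition _ :=
  GRing.isSubringClosed.Build (M -> R) smooth smooth_subring_closed.

Lemma smooth_scaler_closed : GRing.scaler_closed smooth.
Proof.
move=> a f fS; suff -> : a *: f = (cst a : M -> R) * f.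
  by rewrite rpredM//; apply/smoothP => c _ k; apply: (@Ck_cst _ _ _ _ a); exact: open_ccod.
by [].
Qed.

HB.instance Definition _ :=
  GRing.isScaleClosed.Build R (M -> R) smooth smooth_scaler_closed.

Record smoothFun := SmoothFun {
  smoothFun_val :> M -> R ;
  smoothFunP : smoothFun_val \in smooth }.

HB.instance Definition _ := [isSub for smoothFun_val].
HB.instance Definition _ := [Choice of smoothFun by <:].
HB.instance Definition _ := GRing.SubChoice_isSubComPzRing.Build (M -> R) smooth
  smoothFun smooth_subring_closed.
HB.instance Definition _ := [SubZmodule_isSubLmodule of smoothFun by <:].

End SmoothFunctions.

Arguments smooth {R n} M.

Section Tangent.
Context {R : realType} {n : nat} (M : manifold R n).

(* Tangent vectors at [p] are the R-linear derivations at [p] of the algebra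
   of smooth functions. *)
Section TangentSpace.
Variable p : M.

Definition derivation_at : {pred smoothFun M -> R} :=
  [pred v : smoothFun M -> R |
    `[< scalar v /\ forall f h, v (f * h) = f p * v h + v f * h p >]].

Lemma derivation_atP (v : smoothFun M -> R) :
  reflect (scalar v /\ forall f h, v (f * h) = f p * v h + v f * h p)
          (v \in derivation_at).
Proof. exact: asboolP. Qed.

Lemma derivation_at_submod_closed : submod_closed derivation_at.
Proof.
split=> [|a u v /derivation_atP[uL uM] /derivation_atP[vL vM]].
  apply/derivation_atP; split=> [b f h|f h]; rewrite /GRing.zero/=.
    by rewrite mulr0 addr0.
  by rewrite mulr0 mul0r addr0.
apply/derivation_atP; split=> [b f h|f h].
  change (a * u (b *: f + h) + v (b *: f + h) =
    b * (a * u f + v f) + (a * u h + v h)).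
  by rewrite uL vL; ring.
change (a * u (f * h) + v (f * h) =
  f p * (a * u h + v h) + (a * u f + v f) * h p).
by rewrite uM vM; ring.
Qed.

HB.instance Definition _ := GRing.isSubmodClosed.Build R (smoothFun M -> R)
  derivation_at derivation_at_submod_closed.

Record tangent := Tangent {
  tangent_val :> smoothFun M -> R ;
  tangentP : tangent_val \in derivation_at }.

HB.instance Definition _ := [isSub for tangent_val].
HB.instance Definition _ := [Choice of tangent by <:].
HB.instance Definition _ := [SubChoice_isSubLmodule of tangent by <:].

End TangentSpace.

(* Smooth vector fields are the R-linear derivations of the algebra of smooth
   functions.  The regular module [^o] makes them a module over that algebra:
   [f *: X] has a smooth coefficient [f]. *)
Definition derivation : {pred smoothFun M -> (smoothFun M)^o} :=
  [pred X : smoothFun M -> (smoothFun M)^o |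
    `[< linear (X : smoothFun M -> smoothFun M) /\
        forall f h : smoothFun M, X (f * h) = f * X h + X f * h >]].

Lemma derivationP (X : smoothFun M -> (smoothFun M)^o) :
  reflect (linear (X : smoothFun M -> smoothFun M) /\
           forall f h : smoothFun M, X (f * h) = f * X h + X f * h)
          (X \in derivation).
Proof. exact: asboolP. Qed.

Lemma derivation_submod_closed : submod_closed derivation.
Proof.
split=> [|a X Y /derivationP[XL XM] /derivationP[YL YM]].
  apply/derivationP; split=> [b f h|f h].
    change (0 = b *: 0 + 0 :> smoothFun M); by rewrite scaler0 addr0.
  change (0 = f * 0 + 0 * h :> smoothFun M); by rewrite mulr0 mul0r addr0.
apply/derivationP; split=> [b f h|f h].
  change (a * X (b *: f + h) + Y (b *: f + h) =
    b *: (a * X f + Y f) + (a * X h + Y h) :> smoothFun M).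
  rewrite XL YL; apply/val_inj/funext => x.
  change (a x * (b * X f x + X h x) + (b * Y f x + Y h x) =
    b * (a x * X f x + Y f x) + (a x * X h x + Y h x)); ring.
change (a * X (f * h) + Y (f * h) =
  f * (a * X h + Y h) + (a * X f + Y f) * h :> smoothFun M).
by rewrite XM YM; apply/val_inj/funext => x;
  change (a x * (f x * X h x + X f x * h x) + (f x * Y h x + Y f x * h x) =
    f x * (a x * X h x + Y h x) + (a x * X f x + Y f x) * h x); ring.
Qed.

HB.instance Definition _ := GRing.isSubmodClosed.Build (smoothFun M)
  (smoothFun M -> (smoothFun M)^o) derivation derivation_submod_closed.

Record vfield := VField {
  vfield_val :> smoothFun M -> (smoothFun M)^o ;
  vfieldP : vfield_val \in derivation }.

HB.instance Definition _ := [isSub for vfield_val].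
HB.instance Definition _ := [Choice of vfield by <:].
HB.instance Definition _ := [SubChoice_isSubLmodule of vfield by <:].

Lemma vfield_at_subproof (X : vfield) (p : M) :
  (fun f => (X f : smoothFun M) p) \in derivation_at p.
Proof.
have /derivationP[XL XM] := vfieldP X.
by apply/derivation_atP; split=> [a f h|f h]; rewrite ?XL ?XM.
Qed.

Definition vfield_at (X : vfield) (p : M) : tangent p :=
  Tangent (vfield_at_subproof X p).

Lemma lie_bracket_subproof (X Y : vfield) :
  (fun f => X (Y f) - Y (X f)) \in derivation.
Proof.
have [/derivationP[XL XM] /derivationP[YL YM]] := (vfieldP X, vfieldP Y).
apply/derivationP; split=> [a f h|f h].
  rewrite YL !XL YL; apply/val_inj/funext => x.
  change (a * X (Y f) x + X (Y h) x - (a * Y (X f) x + Y (X h) x) =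
    a * (X (Y f) x - Y (X f) x) + (X (Y h) x - Y (X h) x)); ring.
have XD u v : X (u + v) = X u + X v by have := XL 1 u v; rewrite !scale1r.
have YD u v : Y (u + v) = Y u + Y v by have := YL 1 u v; rewrite !scale1r.
rewrite XM YM XD YD !XM !YM; apply/val_inj/funext => x.
change (f x * X (Y h) x + X f x * Y h x + (Y f x * X h x + X (Y f) x * h x) -
   (f x * Y (X h) x + Y f x * X h x + (X f x * Y h x + Y (X f) x * h x)) =
   f x * (X (Y h) x - Y (X h) x) + (X (Y f) x - Y (X f) x) * h x); ring.
Qed.

Definition lie_bracket (X Y : vfield) : vfield :=
  VField (lie_bracket_subproof X Y).

End Tangent.

Section Lorentz.
Context {R : realType} {n : nat} (M : manifold R n).

Record lorentz_metric := LorentzMetric {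
  metric_at : forall p : M, {biscalar tangent p} ;
  metric_sym : forall p (u v : tangent p), metric_at p u v = metric_at p v u ;
  metric_smooth : forall X Y : vfield M,
    (fun p => metric_at p (vfield_at X p) (vfield_at Y p)) \in smooth M ;
  (* each tangent space has a basis with Gram matrix diag(-1, 1, ..., 1) *)
  metric_signature : forall p : M, exists e : 'I_n -> tangent p,
    (forall v, exists! a : 'rV[R]_n, v = \sum_i a 0 i *: e i) /\
    (forall i j, metric_at p (e i) (e j) =
      if i == j then if val i == 0%N then -1 else 1 else 0) }.

Variable g : lorentz_metric.

Definition metric (X Y : vfield M) : smoothFun M :=
  SmoothFun (metric_smooth g X Y).

Implicit Types (D : vfield M -> vfield M -> vfield M) (X Y Z P : vfield M).

(* [D X Y] stands for the covariant derivative of [Y] along [X]. *)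
Record connection D : Prop := Connection {
  connection_linear : forall (f : smoothFun M) X Y Z,
    D (f *: X + Y) Z = f *: D X Z + D Y Z ;
  connection_additive : forall X Y Z, D X (Y + Z) = D X Y + D X Z ;
  connection_leibniz : forall (f : smoothFun M) X Y,
    D X (f *: Y) = (X f : smoothFun M) *: Y + f *: D X Y }.

Definition torsion_free D :=
  forall X Y, D X Y - D Y X = lie_bracket X Y.

Definition metric_compatible D :=
  forall X Y Z, X (metric Y Z) = metric (D X Y) Z + metric Y (D X Z).

Definition levi_civita D :=
  [/\ connection D, torsion_free D & metric_compatible D].

Definition flat P : vfield M -> smoothFun M := fun X => metric X P.

(* (D_X pi)(Y), for a 1-form pi. *)
Definition cov_deriv_form D (pi : vfield M -> smoothFun M) X Y : smoothFun M :=
  X (pi Y) - pi (D X Y).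

(* In the next three definitions [D] is meant to be the Levi-Civita connection
   of [g]; the connection being qualified is the semi-symmetric metric
   connection built from [D] and its generator [P]. *)

Definition semi_symmetric_metric_connection D P X Y : vfield M :=
  D X Y + flat P Y *: X - metric X Y *: P.

Definition concircularly_semi_symmetric D P := exists omega : smoothFun M, forall X Y,
  cov_deriv_form D (flat P) X Y - flat P X * flat P Y = omega * metric X Y.

Definition semi_symmetric_metric_P_connection D P := forall X,
  semi_symmetric_metric_connection D P X P = 0.

Definition unit_timelike P := metric P P = -1.

End Lorentz.

(* Main.v *)
Require Import Defs.
From mathcomp Require Import all_boot all_order all_algebra.
From mathcomp Require Import all_classical all_reals all_analysis.
From mathcomp Require Import ring lra.

(** Since the Levi-Civita connection D is metric, (D_X pi)(Y) = g(Y, D_X P),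
    so the concircular condition reads
      g(Y, D_X P) = omega g(X, Y) + pi(X) pi(Y).
    As g(P, P) is constant, D_X P is orthogonal to P; taking X = Y = P then
    gives 0 = -omega + 1, so omega = 1 ([concircular_factor_eq1]).  Let Z be
    the derivative of P along X for the semi-symmetric connection, that is,
    Z = D_X P - X - pi(X) P.  The condition with omega = 1 says exactly that
    g(Y, Z) = 0 for every vector field Y.

    To conclude Z = 0 from nondegeneracy of g, one would extend an arbitrary
    tangent vector to a global vector field, which takes bump functions.
    Testing against the two fields Y = P and Y = Z is enough: at each point Z
    is null and orthogonal to the timelike vector P, and in Lorentzian
    signature only the zero vector is ([lorentz_null_orthogonal_eq0]). *)

Set Implicit Arguments.
Unset Strict Implicit.
Unset Printing Implicit Defensive.

Import Order.TTheory GRing.Theory Num.Theory.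
Local Open Scope ring_scope.

(** The orthogonal complement of a timelike vector is positive definite.
    With a0, b0 the time coordinates of u and v in a Lorentz basis,
    w = a0 v - b0 u has no time coordinate, so g(w, w) >= 0 with equality only
    for w = 0, while orthogonality gives
    g(w, w) = a0^2 g(v, v) + b0^2 g(u, u) <= 0. *)
Lemma lorentz_null_orthogonal_eq0 (R : realType) (n : nat) (M : manifold R n)
    (g : lorentz_metric M) (p : M) (u v : tangent p) : (0 < n)%N ->
  metric_at g p u u < 0 -> metric_at g p u v = 0 -> metric_at g p v v <= 0 ->
  v = 0.
Proof.
move=> n_gt0 uu uv vv; pose i0 := Ordinal n_gt0.
have [e [coord ee]] := metric_signature g p.
have spacelike (c : 'I_n -> R) : c i0 = 0 -> let w := \sum_i c i *: e i in
    metric_at g p w w <= 0 -> w = 0.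
  move=> c0 w; have -> : metric_at g p w w = \sum_i c i ^+ 2.
    rewrite linear_sumlz; apply: eq_bigr => i _.
    rewrite linear_sumr (bigD1 i)//= big1 ?addr0.
      rewrite linearZl_LR linearZr_LR /= ee eqxx.
      case: ifP => [i_0|_]; last by rewrite /= /GRing.scale/=; ring.
      (* The sign -1 of the time direction is harmless, as c vanishes there. *)
      have -> : i = i0 by apply: val_inj; exact/eqP.
      by rewrite c0 /GRing.scale/=; ring.
    move=> j ji; rewrite linearZl_LR linearZr_LR /= ee eq_sym (negbTE ji).
    by rewrite /GRing.scale/=; ring.
  move=> sq_le0; have /psumr_eq0P c_eq0 : \sum_i c i ^+ 2 = 0.
    by apply/eqP; rewrite eq_le sq_le0 sumr_ge0// => i _; exact: sqr_ge0.
  rewrite /w big1// => i _.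
  have /eqP := c_eq0 (fun i _ => sqr_ge0 _) i isT.
  by rewrite sqrf_eq0 => /eqP ->; rewrite scale0r.
have [a [ua _]] := coord u; have [b [vb _]] := coord v.
pose w := a 0 i0 *: v - b 0 i0 *: u.
have a_neq0 : a 0 i0 != 0.
  apply/eqP => a0; have := spacelike (a 0) a0; rewrite -ua /= => /(_ (ltW uu)) u0.
  by move: uu; rewrite u0 linear0l ltxx.
have ww : metric_at g p w w =
    a 0 i0 ^+ 2 * metric_at g p v v + b 0 i0 ^+ 2 * metric_at g p u u.
  rewrite /w linearBl 2!linearBr !linearZl_LR !linearZr_LR /= /GRing.scale/=.
  by rewrite (Defs.metric_sym g v u) uv; ring.
have ww_le0 : metric_at g p w w <= 0.
  rewrite ww; have := sqr_ge0 (a 0 i0); have := sqr_ge0 (b 0 i0); nra.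
have w0 : w = 0.
  have wE : w = \sum_i (a 0 i0 * b 0 i - b 0 i0 * a 0 i) *: e i.
    rewrite /w {1}vb {1}ua !scaler_sumr -sumrB; apply: eq_bigr => i _.
    by rewrite !scalerA scalerBl.
  by rewrite wE; apply: spacelike; [ring|rewrite /= -wE].
(* u is timelike, so a nonzero b0 would make g(w, w) < 0. *)
have b0 : b 0 i0 = 0.
  move: ww; rewrite w0 linear0l => ww.
  have := sqr_ge0 (a 0 i0); have := sqr_ge0 (b 0 i0) => bb aa.
  by apply/eqP; rewrite -sqrf_eq0; apply/eqP; nra.
move: w0; rewrite /w b0 scale0r subr0 => /eqP.
by rewrite scaler_eq0 (negbTE a_neq0) => /eqP.
Qed.

Section VectorFields.
Context {R : realType} {n : nat} (M : manifold R n).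
Implicit Types (X Y Z P : vfield M) (f : smoothFun M) (p : M).

Lemma vfield_atD X Y p : vfield_at (X + Y) p = vfield_at X p + vfield_at Y p.
Proof. exact: val_inj. Qed.

Lemma vfield_atB X Y p : vfield_at (X - Y) p = vfield_at X p - vfield_at Y p.
Proof. exact: val_inj. Qed.

Lemma vfield_atZ f X p : vfield_at (f *: X) p = f p *: vfield_at X p.
Proof. exact: val_inj. Qed.

Lemma vfield_eq0 X : (forall p, vfield_at X p = 0) -> X = 0.
Proof.
move=> X0; apply/val_inj/funext => f; apply/val_inj/funext => p.
by have /(congr1 (fun v : tangent p => v f)) := X0 p.
Qed.

Lemma vfield_const1 X : X 1 = 0 :> smoothFun M.
Proof.
have /derivationP[_ XM] := vfieldP X; have := XM 1 1.
by rewrite !mulr1 mul1r => /eqP; rewrite -subr_eq0 opprD addNKr oppr_eq0 => /eqP.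
Qed.

Lemma vfieldN X f : X (- f) = - (X f : smoothFun M) :> smoothFun M.
Proof.
have /derivationP[XL _] := vfieldP X.
have X0 : X 0 = 0 :> smoothFun M.
  by have := XL (-1) 0 0; rewrite scaler0 addr0 scaleN1r addNr.
by have := XL (-1) f 0; rewrite !scaleN1r X0 !addr0.
Qed.

Variable g : lorentz_metric M.

Lemma metricE X Y p :
  metric g X Y p = metric_at g p (vfield_at X p) (vfield_at Y p).
Proof. by []. Qed.

Lemma metricC X Y : metric g X Y = metric g Y X.
Proof. by apply/val_inj/funext => p; exact: Defs.metric_sym. Qed.

Variable D : vfield M -> vfield M -> vfield M.
Hypothesis compatD : metric_compatible g D.

(** Metric compatibility X g(Y, P) = g(D_X Y, P) + g(Y, D_X P) moves the
    covariant derivative from the dual form of P to P itself. *)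
Lemma cov_deriv_flat P X Y :
  cov_deriv_form D (flat g P) X Y = metric g Y (D X P).
Proof. by rewrite /cov_deriv_form /flat compatD addrC addKr. Qed.

(** Differentiating the constant g(P, P) along X gives 2 g(P, D_X P) = 0. *)
Lemma unit_timelike_orthogonal_deriv P X : unit_timelike g P ->
  metric g P (D X P) = 0.
Proof.
move=> PP; have := compatD X P P.
rewrite PP vfieldN vfield_const1 oppr0 (metricC (D X P)) => /esym.
move/(congr1 (fun f : smoothFun M => (f : M -> R))) => h.
apply/val_inj/funext => p; have := congr1 (@^~ p) h.
set m := metric _ _ _; change (m p + m p = 0 -> m p = 0); lra.
Qed.

(** The function omega is read off at X = Y = P, where the covariant
    derivative of pi vanishes and pi(P) = g(P, P) = -1. *)
Lemma concircular_factor_eq1 P omega : unit_timelike g P ->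
  (forall X Y, cov_deriv_form D (flat g P) X Y - flat g P X * flat g P Y =
    omega * metric g X Y) -> omega = 1.
Proof.
move=> PP /(_ P P); rewrite cov_deriv_flat unit_timelike_orthogonal_deriv//.
by rewrite /flat PP mulrNN mulr1 sub0r mulrN1 => /oppr_inj.
Qed.

End VectorFields.

Theorem theorem3p1 (R : realType) (n : nat) (M : manifold R n)
    (g : lorentz_metric M) (D : vfield M -> vfield M -> vfield M) (P : vfield M) :
  (2 < n)%N ->
  levi_civita g D ->
  concircularly_semi_symmetric g D P ->
  unit_timelike g P ->
  semi_symmetric_metric_P_connection g D P.
Proof.
move=> n_gt2 [_ _ compatD] [omega conc] PP X.
have omega1 := concircular_factor_eq1 compatD PP conc.
set Z := semi_symmetric_metric_connection g D P X P.
have orthZ Y : metric g Y Z = 0.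
  have := conc X Y; rewrite cov_deriv_flat// omega1 mul1r => DXP.
  apply/val_inj/funext => p.
  have := congr1 (fun f : smoothFun M => f p) DXP.
  have := congr1 (fun f : smoothFun M => f p) PP.
  change (metric g P P p = -1 ->
    metric g Y (D X P) p - metric g X P p * metric g Y P p = metric g X Y p ->
    metric g Y Z p = 0).
  rewrite (metricC g X Y) (metricE g Y Z) /Z /semi_symmetric_metric_connection.
  rewrite vfield_atB vfield_atD !vfield_atZ linearBr linearDr !linearZr_LR /=.
  rewrite -!metricE /flat /GRing.scale/= => -> DXPp; lra.
apply: vfield_eq0 => p.
have orthZp Y : metric_at g p (vfield_at Y p) (vfield_at Z p) = 0.
  exact: (congr1 (fun f : smoothFun M => f p) (orthZ Y)).
apply: (@lorentz_null_orthogonal_eq0 _ _ _ g _ (vfield_at P p)).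
- exact: leq_trans n_gt2.
- have -> : metric_at g p (vfield_at P p) (vfield_at P p) = -1.
    exact: (congr1 (fun f : smoothFun M => f p) PP).
  by rewrite oppr_lt0 ltr01.
- exact: orthZp.
- by rewrite orthZp.
Qed.
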